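(* Let $\mu$ be a Borel probability measure on a compact metric space $X$ and let $f: X\to X$ be a $\mu$-expansive homeomorphism. Then the set of points with converging semi-orbits under $f$ has $\mu$-measure $0$.
   Context: For a homeomorphism $f$ of a metric space $(X,d)$, $x\in X$ and $\delta>0$, put $\Gamma_\delta(x)=\{y\in X: d(f^i(x),f^i(y))\leq\delta \text{ for all } i\in\mathbb{Z}\}$. Given a Borel probability measure $\mu$ on $X$, $f$ is called $\mu$-expansive if there is $\delta>0$ such that $\mu(\Gamma_\delta(x))=0$ for all $x\in X$. For $z\in X$, $\omega(z)$ (resp. $\alpha(z)$) is the set of points $x$ of the form $x=\lim_{k\to\infty}f^{n_k}(z)$ for some sequence of integers $n_k\to\infty$ (resp. $n_k\to-\infty$). A point $z\in X$ is a point with converging semi-orbits under $f$ if both $\alpha(z)$ and $\omega(z)$ consist of a unique point. *)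

(* Defs.v *)
From HB Require Import structures.
From mathcomp Require Import all_boot all_order all_algebra.
From mathcomp Require Import all_classical all_reals all_analysis.

Set Implicit Arguments.
Unset Strict Implicit.
Unset Printing Implicit Defensive.

Import Order.TTheory GRing.Theory Num.Theory.
Local Open Scope classical_set_scope.
Local Open Scope ring_scope.

(* The library's measurable types are pointed, hence the distinguished point.
   It costs no generality: a space carrying a probability measure is
   nonempty. *)
#[short(type="pointedMetricType")]
HB.structure Definition PointedMetric (R : numDomainType) :=
  {T of Pointed T & Metric R T}.

Notation borel X := (g_sigma_algebraType (@open X)).

Record homeomorphism (T : topologicalType) := Homeomorphism {
  homeo_fun :> T -> T;
  homeo_inv : T -> T;
  homeo_funK : cancel homeo_fun homeo_inv;
  homeo_invK : cancel homeo_inv homeo_fun;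
  homeo_fun_continuous : continuous homeo_fun;
  homeo_inv_continuous : continuous homeo_inv
}.

(* [Negz n] is the integer -(n+1). *)
Definition ziter (T : topologicalType) (f : homeomorphism T) (i : int) : T -> T :=
  match i with
  | Posz n => iter n f
  | Negz n => iter n.+1 (homeo_inv f)
  end.

Definition Gamma (R : realType) (X : metricType R) (f : homeomorphism X)
    (delta : R) (x : X) : set X :=
  [set y | forall i : int, mdist (ziter f i x) (ziter f i y) <= delta].

Definition mu_expansive (R : realType) (X : pointedMetricType R)
    (mu : probability (borel X) R) (f : homeomorphism X) : Prop :=
  exists2 delta : R, 0 < delta & forall x : X, mu (Gamma f delta x) = 0%E.

Definition omega_limit (T : topologicalType) (f : homeomorphism T) (z : T) :
    set T :=
  [set x | exists2 n : nat -> int,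
    (forall M : int, \forall k \near \oo, M <= n k) &
    ziter f (n k) z @[k --> \oo] --> x].

Definition alpha_limit (T : topologicalType) (f : homeomorphism T) (z : T) :
    set T :=
  [set x | exists2 n : nat -> int,
    (forall M : int, \forall k \near \oo, n k <= M) &
    ziter f (n k) z @[k --> \oo] --> x].

Definition converging_semi_orbits (T : topologicalType) (f : homeomorphism T) :
    set T :=
  [set z | (exists a, alpha_limit f z = [set a]) /\
           (exists b, omega_limit f z = [set b])].

(* Main.v *)
Require Import Defs.
From mathcomp Require Import all_boot all_order all_algebra.
From mathcomp Require Import all_classical all_reals all_analysis.
From mathcomp Require Import lra.

Import Order.TTheory GRing.Theory Num.Theory.
Import numFieldNormedType.Exports.
Local Open Scope classical_set_scope.
Local Open Scope ring_scope.

(** Let delta be an expansivity constant and let (c j) be a countable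
    delta/2-net of X. When both semi-orbits of z converge, each of them can be
    tracked within delta/2 by an eventually constant sequence of net points:
    from some time on it stays close to a net point near its limit
    ([cvgn_itinerary]). There are only countably many eventually constant
    sequences of indices, hence countably many pairs of itineraries. Two points
    with the same pair of itineraries stay within delta of each other at all
    times, so every class of points with a given pair of itineraries lies in
    Gamma_delta z for any z in it ([same_itinerary_Gamma]); this set is null by
    expansivity. The points with converging semi-orbits are thus covered by
    countably many null sets.

    This bounds the measure of the set only once the set is known to be Borel.
    For that, compactness is used twice. A sequence of a compact metric space
    has a single limit point exactly when it converges
    ([cluster_set1_cvgE]), so that the condition on the limit sets of z says
    that the two semi-orbits of z converge ([converging_semi_orbitsE]); and
    convergence is the Cauchy property ([cvgn_cauchyE]), a countable
    combination of strict inequalities between continuous functions of z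
    ([measurable_cvgn]). *)

(** * Limit points of sequences in a metric space *)

Lemma near_nat_geP (P : nat -> Prop) :
  (\forall n \near \oo, P n) <-> exists N, forall n, (N <= n)%N -> P n.
Proof. by split=> [[N _ H]|[N H]]; exists N. Qed.

Lemma cvgn_mdistP {R : realType} {X : metricType R} (u : nat -> X) (x : X) :
  u @ \oo --> x <->
  forall e, 0 < e -> exists N, forall n, (N <= n)%N -> mdist x (u n) < e.
Proof.
split=> [ux e e0|H].
  exact/near_nat_geP/(metricType_numDomainType.cvgrPdist_lt _ _).1.
apply/metricType_numDomainType.cvgrPdist_lt => e e0.
exact/near_nat_geP/H.
Qed.

Lemma cluster_mdistP {R : realType} {X : metricType R} (u : nat -> X) (x : X) :
  cluster (u @ \oo) x <->
  forall e N, 0 < e -> exists2 n, (N <= n)%N & mdist x (u n) < e.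
Proof.
split=> [clx e N e0|H A B].
  have [_ [[n /= Nn <-] xn]] : u @` [set n | (N <= n)%N] `&` ball x e !=set0.
    apply: clx; last exact: nbhsx_ballx.
    by exists N => // n /= Nn; exists n.
  by exists n => //; move: xn; rewrite ballEmdist.
move=> [N _ NA] /nbhs_ballP[e /= e0 eB].
have [n Nn xn] := H e N e0.
by exists (u n); split; [exact: NA|apply: eB; rewrite ballEmdist].
Qed.

(** Subsequential limits along integer times tending to infinity are cluster
    points along the natural numbers: integer times are eventually
    nonnegative, and conversely a cluster point is approached at rate
    1/(k+1) by choosing a time beyond k. Taking [u] to be an orbit, or an
    orbit run backwards, this covers both the omega- and the alpha-limit set. *)
Lemma limit_pointsE {R : realType} {X : metricType R} (u : int -> X) :
  [set x | exists2 n : nat -> int,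
    (forall M : int, \forall k \near \oo, M <= n k) &
    u (n k) @[k --> \oo] --> x] = cluster (u (Posz n) @[n --> \oo]).
Proof.
apply/seteqP; split=> x /=.
  move=> [n ninfty /cvgn_mdistP unx]; apply/cluster_mdistP => e N e0.
  have [K1 K1e] := unx e e0.
  have [K2 K2N] := (near_nat_geP _).1 (ninfty (Posz N)).
  have := K2N _ (leq_maxr K1 K2); have := K1e _ (leq_maxl K1 K2).
  by case: (n (maxn K1 K2)) => // m xm Nm; exists m.
move=> /cluster_mdistP clx.
have /choice[n nP] (k : nat) :
    exists n, (k <= n)%N /\ mdist x (u (Posz n)) < k.+1%:R^-1.
  have [|n kn xn] := clx k.+1%:R^-1 k; first by rewrite invr_gt0.
  by exists n.
exists (fun k => Posz (n k)).
  move=> M; apply/near_nat_geP; exists `|M|%N => k Mk.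
  apply: le_trans (ler_norm M) _; rewrite -abszE lez_nat.
  exact: leq_trans Mk (nP k).1.
apply/cvgn_mdistP => e e0.
have /near_nat_geP[N NP] := near_infty_natSinv_lt (PosNum e0).
by exists N => k Nk; apply: lt_trans (nP k).2 (NP k Nk).
Qed.

(** If a sequence does not converge to its unique cluster point, infinitely
    many terms stay away from that point and, by compactness, accumulate
    somewhere else. *)
Lemma cluster_set1_cvgE {R : realType} {X : pointedMetricType R} (u : nat -> X) :
  compact [set: X] ->
  (exists a, cluster (u @ \oo) = [set a]) <-> exists a : X, u @ \oo --> a.
Proof.
move=> cX; split=> -[a ua]; exists a.
  apply: (compact_cluster_set1 (V := setT)) => //; last exact: filterT.
    exact: metric_hausdorff.
  exact: filterT.
apply/seteqP; split=> [x clx|_ ->].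
  apply: (@metric_hausdorff R X) => A B Ax Ba.
  by have [y [? ?]] := clx _ _ (ua _ Ba) Ax; exists y; split.
by move=> A B ? ?; exact: (@filter_ex _ (u @ \oo) _ (A `&` B) (filterI _ (ua _ _))).
Qed.

(** The Cauchy condition compares all later terms with the single term [u N]
    and uses the countable family of bounds 1/(k+1), so that only countable
    quantifiers over natural numbers occur, as measurability requires. *)
Lemma cvgn_cauchyE {R : realType} {X : pointedMetricType R} (u : nat -> X) :
  compact [set: X] ->
  (exists a : X, u @ \oo --> a) <->
  forall k, exists N, forall n, mdist (u N) (u (N + n)%N) < k.+1%:R^-1.
Proof.
move=> cX; split=> [[a /cvgn_mdistP ua] k|cu].
  have [|N Na] := ua (k.+1%:R^-1 / 2); first by rewrite divr_gt0 ?invr_gt0.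
  exists N => n; apply: le_lt_trans (metric_triangle _ a _) _.
  rewrite [ltRHS]splitr metric_sym ltrD ?Na ?leq_addr//.
have /cvg_ex[a ua] : cvg (u @ \oo); last by exists a.
apply: (compact_cauchy_cvg (U := setT)) => //; last exact: filterT.
apply: cauchy_exP => e e0.
have /near_nat_geP[k /(_ _ (leqnn k)) ke] := near_infty_natSinv_lt (PosNum e0).
have [N NP] := cu k; exists (u N); apply/near_nat_geP; exists N => n Nn.
by rewrite ballEmdist/= -(subnKC Nn); exact: lt_trans (NP _) ke.
Qed.

(** * Borel sets of orbits *)

Lemma continuous_mdist {R : realType} {X : metricType R}
    {T : topologicalType} (g h : T -> X) :
  continuous g -> continuous h ->
  continuous (fun z => mdist (g z) (h z) : R).
Proof.
move=> cg ch z; apply/cvgrPdist_lt => e e0.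
have e20 : 0 < e / 2 by rewrite divr_gt0.
have gz : \forall t \near z, mdist (g z) (g t) < e / 2.
  exact/(metricType_numDomainType.cvgrPdist_lt _ _).1/e20/cg.
have hz : \forall t \near z, mdist (h z) (h t) < e / 2.
  exact/(metricType_numDomainType.cvgrPdist_lt _ _).1/e20/ch.
apply: filterS2 gz hz => t gzt hzt.
have t1 := metric_triangle (g z) (g t) (h z).
have t2 := metric_triangle (g t) (h t) (h z).
have t3 := metric_triangle (g t) (g z) (h t).
have t4 := metric_triangle (g z) (h z) (h t).
have := metric_sym (g t) (g z); have := metric_sym (h t) (h z).
by move=> s1 s2; rewrite ltr_norml; lra.
Qed.

Lemma continuous_iter {T : topologicalType} (g : T -> T) n :
  continuous g -> continuous (iter n g).
Proof.
move=> cg; elim: n => [|n IH] x; first exact: cvg_id.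
exact: continuous_comp (IH x) (cg _).
Qed.

Lemma continuous_ziter {T : topologicalType} (f : homeomorphism T) i :
  continuous (ziter f i).
Proof.
case: i => n; apply: continuous_iter.
  exact: homeo_fun_continuous.
exact: homeo_inv_continuous.
Qed.

Lemma open_borel {T : ptopologicalType} (A : set T) :
  open A -> measurable (A : set (borel T)).
Proof. exact: sub_sigma_algebra. Qed.

Lemma closed_borel {T : ptopologicalType} (A : set T) :
  closed A -> measurable (A : set (borel T)).
Proof.
move=> cA; rewrite -[A]setCK; apply: measurableC; apply: open_borel.
exact: closed_openC.
Qed.

Lemma measurable_cvgn {R : realType} {X : pointedMetricType R}
    (g : nat -> X -> X) :
  compact [set: X] -> (forall n, continuous (g n)) ->
  measurable ([set z | exists a : X, g n z @[n --> \oo] --> a] : set (borel X)).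
Proof.
move=> cX cg.
have -> : [set z | exists a : X, g n z @[n --> \oo] --> a] =
    \bigcap_k \bigcup_N \bigcap_n
      [set z | mdist (g N z) (g (N + n)%N z) < k.+1%:R^-1 :> R].
  apply/seteqP; split=> z /=.
    move=> /(cvgn_cauchyE _ cX) cz k _; have [N NP] := cz k.
    by exists N => // n _; exact: NP.
  move=> H; apply/(cvgn_cauchyE _ cX) => k.
  by have [N _ NP] := H k I; exists N => n; exact: NP.
apply: bigcapT_measurable => k; apply: bigcupT_measurable => N.
apply: bigcapT_measurable => n; apply: open_borel.
apply: (@open_comp _ _ (fun z => mdist (g N z) (g (N + n)%N z)) [set x : R | x < _]).
  by move=> z _; exact: continuous_mdist.
exact: open_lt.
Qed.

Lemma closed_Gamma {R : realType} {X : metricType R} (f : homeomorphism X)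
  (delta : R) (x : X) : closed (Gamma f delta x).
Proof.
rewrite (_ : Gamma f delta x = \bigcap_i
    [set y | mdist (ziter f i x) (ziter f i y) <= delta]); last first.
  by apply/seteqP; split=> y yG i; first move=> _; exact: yG.
apply: closed_bigI => i _.
apply: (@closed_comp _ _ (fun y => mdist (ziter f i x) (ziter f i y))
  [set r : R | r <= delta]); last exact: closed_le.
move=> y _; apply: continuous_mdist; last exact: continuous_ziter.
by move=> z; exact: cvg_cst.
Qed.

(** * Itineraries *)

Lemma compact_countable_net {R : realType} {X : pointedMetricType R} (e : R) :
  compact [set: X] -> 0 < e ->
  exists c : nat -> X, forall x, exists j, mdist (c j) x < e.
Proof.
rewrite compact_cover => cX e0.
have [|x _|D _ DP] := cX X setT (fun x => (ball x e)^°).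
- by move=> x _; exact: open_interior.
- by exists x => //; exact: nbhsx_ballx.
exists (nth point (finmap.enum_fset D)) => x.
have [y yD /interior_subset] := DP x I; rewrite ballEmdist => yx.
by exists (index y (finmap.enum_fset D)); rewrite nth_index.
Qed.

(** The pair [p = (s, j)] codes the eventually constant sequence that lists [s]
    and then repeats [j], namely [n |-> nth j s n]; such codes form a countable
    type. Here [j] is the index of a net point near the limit, and the strict
    inequality leaves room for it to be near all late terms as well. *)
Lemma cvgn_itinerary {R : realType} {X : metricType R} (c : nat -> X) (e : R)
    (u : nat -> X) (a : X) :
  (forall x, exists j, mdist (c j) x < e) -> u @ \oo --> a ->
  exists p : seq nat * nat, forall n, mdist (c (nth p.2 p.1 n)) (u n) < e.
Proof.
move=> cP ua; have [j ja] := cP a.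
have [|N NP] := (cvgn_mdistP _ _).1 ua (e - mdist (c j) a).
  by rewrite subr_gt0.
have /choice[s sP] n : exists i, mdist (c i) (u n) < e by exact: cP.
exists (mkseq s N, j) => n /=; have [nN|Nn] := ltnP n N.
  by rewrite nth_mkseq.
rewrite nth_default ?size_mkseq//.
apply: le_lt_trans (metric_triangle _ a _) _.
by rewrite -ltrBrDl; exact: NP.
Qed.

Lemma ziterN {T : topologicalType} (f : homeomorphism T) n x :
  ziter f (- Posz n) x = iter n (homeo_inv f) x.
Proof. by case: n. Qed.

(** * Points with converging semi-orbits *)

Lemma converging_semi_orbitsE {R : realType} {X : pointedMetricType R}
    (f : homeomorphism X) : compact [set: X] ->
  converging_semi_orbits f =
  [set z | exists a : X, iter n (homeo_inv f) z @[n --> \oo] --> a] `&`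
  [set z | exists b : X, iter n f z @[n --> \oo] --> b].
Proof.
move=> cX.
have omegaE z : omega_limit f z = cluster (iter n f z @[n --> \oo]).
  exact: (limit_pointsE (fun i => ziter f i z)).
have alphaE z : alpha_limit f z = cluster (iter n (homeo_inv f) z @[n --> \oo]).
  under eq_fun do rewrite -ziterN.
  rewrite -(limit_pointsE (fun i => ziter f (- i) z)).
  apply/seteqP; split=> x [n ninfty nx]; exists (fun k => - n k) => //.
  - by move=> M; apply: filterS (ninfty (- M)) => k; rewrite lerNr.
  - by under eq_fun do rewrite opprK.
  - by move=> M; apply: filterS (ninfty (- M)) => k; rewrite lerNl.
apply/seteqP; split=> z; rewrite /converging_semi_orbits /= alphaE omegaE.
  by move=> [/(cluster_set1_cvgE _ cX) ? /(cluster_set1_cvgE _ cX)].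
by move=> [? ?]; split; exact/(cluster_set1_cvgE _ cX).
Qed.

Lemma same_itinerary_Gamma {R : realType} {X : metricType R}
    (f : homeomorphism X) (delta : R) (c d : nat -> X) (z w : X) :
  (forall n, mdist (c n) (iter n f z) < delta / 2) ->
  (forall n, mdist (d n) (iter n (homeo_inv f) z) < delta / 2) ->
  (forall n, mdist (c n) (iter n f w) < delta / 2) ->
  (forall n, mdist (d n) (iter n (homeo_inv f) w) < delta / 2) ->
  Gamma f delta z w.
Proof.
move=> cz dz cw dw.
have close (a x y : X) : mdist a x < delta / 2 -> mdist a y < delta / 2 ->
    mdist x y <= delta.
  move=> ax ay; apply: le_trans (metric_triangle _ a _) _.
  by rewrite [leRHS]splitr metric_sym lerD// ltW.
by case=> n; [exact: close (cz n) (cw n)|exact: close (dz n.+1) (dw n.+1)].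
Qed.

Theorem theorem4p3 (R : realType) (X : pointedMetricType R)
    (mu : probability (borel X) R) (f : homeomorphism X) :
  compact [set: X] ->
  mu_expansive mu f ->
  mu (converging_semi_orbits f) = 0%E.
Proof.
move=> cX [delta delta0 Gamma0].
have delta20 : 0 < delta / 2 by rewrite divr_gt0.
have [c cP] := compact_countable_net _ cX delta20.
rewrite (converging_semi_orbitsE f cX).
apply: measure_negligible.
  apply: measurableI; apply: measurable_cvgn => // n; apply: continuous_iter.
    exact: homeo_inv_continuous.
  exact: homeo_fun_continuous.
pose follows (g : X -> X) (p : seq nat * nat) (z : X) :=
  forall n, mdist (c (nth p.2 p.1 n)) (iter n g z) < delta / 2.
pose cell (pq : (seq nat * nat) * (seq nat * nat)) :=
  [set z | follows f pq.1 z /\ follows (homeo_inv f) pq.2 z].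
apply: (@negligibleS _ _ _ mu
    (\bigcup_k (if unpickle k is Some pq then cell pq else set0) : set (borel X))).
  move=> z [[a az] [b bz]].
  have [p zp] := cvgn_itinerary _ _ _ _ cP bz.
  have [q zq] := cvgn_itinerary _ _ _ _ cP az.
  by exists (pickle (p, q)) => //; rewrite pickleK.
apply: negligible_bigcup => k.
case: (unpickle k) => [pq|]; last exact: negligible_set0.
have [[z [zp zq]]|/set0P/negP/negPn/eqP->] := pselect (cell pq !=set0);
  last exact: negligible_set0.
apply: (@negligibleS _ _ _ mu (Gamma f delta z : set (borel X))) => [w [wp wq]|].
  exact: same_itinerary_Gamma zp zq wp wq.
apply/negligibleP; last exact: Gamma0.
by apply: closed_borel; exact: closed_Gamma.
Qed.
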